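(* For $n \geq 1$ let $\sigma_n = \sqrt[n+1]{(n+1)!} - \sqrt[n]{n!}$. Then: (a) $\lim_{n \to \infty} \sigma_n = \frac{1}{e}$. (b) $0.42 > \sigma_1 > \sigma_2 > \sigma_3 > \cdots > \frac{1}{e}$. *)

(* Defs.v *)
From Stdlib Require Export Factorial Reals.
From Coquelicot Require Export Coquelicot.
Open Scope R_scope.

(* [Rpower x y = exp (y * ln x)], so this is the real n-th root of x when
   x > 0 and n >= 1. *)
Definition nroot (n : nat) (x : R) : R := Rpower x (/ INR n).

(* Meaningful for n >= 1 only; the value at n = 0 is junk. The trailing
   underscore avoids Stdlib's [sigma]. *)
Definition sigma_ (n : nat) : R :=
  nroot (n + 1) (INR (fact (n + 1))) - nroot n (INR (fact n)).

(* Main.v *)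
Require Import Defs.
From Stdlib Require Import Reals Lra Lia Psatz.
From Coquelicot Require Import Coquelicot.
Open Scope R_scope.

(* Write [a_n] for the [n]-th root of [n!]. The heart of the matter is strict
   concavity of [a], i.e. that sigma decreases. Put [l_m = ln (1 + 1 / m)] and
   let [D_m / (m (m - 1))] be the difference of [l_m] and [ln (a_m / a_(m-1))].
   Then [D_(m+1) = D_m + m g_m], where [g_m = (m + 1) l_(m+1) - m l_m] is close
   to [1 / (2 m^2)], so that [D_m] is nonnegative and grows logarithmically; the
   bound [(D_m + 1/2)^2 <= m / 5] is enough for
   [a_(m-1) / a_m + a_(m+1) / a_m < 2] after expanding the exponentials to
   second order.
   The same estimate gives [a_n / n -> 1 / e], and concavity squeezes [sigma_n]
   between [(a_(2n) - a_n) / n] and [a_(n+1) / n]. A strictly decreasing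
   sequence stays above its limit. *)

(** * Polynomial bounds for [exp] and [ln] *)

Lemma le_of_is_derive_nonneg (f df : R -> R) (a b : R) :
  a <= b ->
  (forall x, a <= x <= b -> is_derive f x (df x)) ->
  (forall x, a <= x <= b -> 0 <= df x) ->
  f a <= f b.
Proof.
intros Hab Hd Hp.
destruct (MVT_gen f a b df) as [c [Hc Heq]];
  rewrite ?Rmin_left, ?Rmax_right in * by lra.
- intros x Hx. apply Hd. lra.
- intros x Hx. apply continuity_pt_filterlim.
  apply (ex_derive_continuous (V := R_NormedModule)).
  exists (df x). now apply Hd.
- pose proof (Hp c Hc). nra.
Qed.

Lemma exp_le_quadratic (x : R) :
  0 <= x <= 1 / 10 -> exp x <= 1 + x + 3 / 5 * x ^ 2.
Proof.
intros Hx.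
pose proof (le_of_is_derive_nonneg (fun t => 1 + t + 3 / 5 * t ^ 2 - exp t)
  (fun t => 1 + 6 / 5 * t - exp t) 0 x) as H.
cbv beta in H. rewrite exp_0 in H.
cut (1 + 0 + 3 / 5 * 0 ^ 2 - 1 <= 1 + x + 3 / 5 * x ^ 2 - exp x); [lra|].
apply H; [lra | |].
- intros t Ht. auto_derive; [easy | field].
- intros t Ht.
  (* From [exp (- t) >= 1 - t] follows [exp t <= 1 / (1 - t)], which is at most [1 + 6 / 5 * t] for
     [t <= 1 / 6]. *)
  assert (He : exp t * exp (- t) = 1)
    by (rewrite <- exp_plus, Rplus_opp_r; apply exp_0).
  pose proof (exp_ineq1_le (- t)). pose proof (exp_pos t). nra.
Qed.

Lemma exp_neg_le_quadratic (z : R) :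
  0 <= z -> exp (- z) <= 1 - z + z ^ 2 / 2.
Proof.
intros Hz.
pose proof (le_of_is_derive_nonneg (fun t => 1 - t + t ^ 2 / 2 - exp (- t))
  (fun t => - 1 + t + exp (- t)) 0 z) as H.
cbv beta in H. rewrite Ropp_0, exp_0 in H.
cut (1 - 0 + 0 ^ 2 / 2 - 1 <= 1 - z + z ^ 2 / 2 - exp (- z)); [lra|].
apply H; [lra | |].
- intros t Ht. auto_derive; [easy | field].
- intros t Ht. pose proof (exp_ineq1_le (- t)). lra.
Qed.

(** In the upper bound the Taylor coefficient [1 / 3] is raised to [1 / 2] to absorb the tail; the
    derivative of that difference stays nonnegative up to [w = 1 / 3]. *)
Lemma ln_1_sub_bounds (w : R) :
  0 <= w <= 1 / 3 ->
  w + w ^ 2 / 2 + w ^ 3 / 3 <= - ln (1 - w) <= w + w ^ 2 / 2 + w ^ 3 / 2.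
Proof.
intros Hw. split.
- pose proof (le_of_is_derive_nonneg
    (fun t => - ln (1 - t) - (t + t ^ 2 / 2 + t ^ 3 / 3))
    (fun t => / (1 - t) - (1 + t + t ^ 2)) 0 w) as H.
  cbv beta in H. rewrite Rminus_0_r, ln_1 in H.
  cut (- 0 - (0 + 0 ^ 2 / 2 + 0 ^ 3 / 3) <=
       - ln (1 - w) - (w + w ^ 2 / 2 + w ^ 3 / 3)); [lra|].
  apply H; [lra | |].
  + intros t Ht. auto_derive; [lra | unfold Rminus; field; lra].
  + intros t Ht.
    replace (/ (1 - t) - (1 + t + t ^ 2)) with (t ^ 3 * / (1 - t)) by (field; lra).
    apply Rmult_le_pos; [apply pow_le; lra | left; apply Rinv_0_lt_compat; lra].
- pose proof (le_of_is_derive_nonneg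
    (fun t => (t + t ^ 2 / 2 + t ^ 3 / 2) + ln (1 - t))
    (fun t => (1 + t + 3 / 2 * t ^ 2) - / (1 - t)) 0 w) as H.
  cbv beta in H. rewrite Rminus_0_r, ln_1 in H.
  cut ((0 + 0 ^ 2 / 2 + 0 ^ 3 / 2) + 0 <=
       (w + w ^ 2 / 2 + w ^ 3 / 2) + ln (1 - w)); [lra|].
  apply H; [lra | |].
  + intros t Ht. auto_derive; [lra | unfold Rminus; field; lra].
  + intros t Ht.
    replace ((1 + t + 3 / 2 * t ^ 2) - / (1 - t))
      with (t ^ 2 * (1 - 3 * t) / 2 * / (1 - t)) by (field; lra).
    apply Rmult_le_pos; [nra | left; apply Rinv_0_lt_compat; lra].
Qed.

(** The terms below order three cancel, leaving [w ^ 3 / 2 - w ^ 4 / 6 + ...]; the constant [4 / 9]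
    is the value of [1 / 2 - w / 6] at [w = 1 / 3]. *)
Lemma ln_cubic_bounds (w : R) :
  0 <= w <= 1 / 3 ->
  4 / 9 * w ^ 3 <= ln (1 + w) + (1 - w) * ln (1 - w) <= w ^ 3 / 2.
Proof.
intros Hw. split.
- pose proof (le_of_is_derive_nonneg
    (fun t => ln (1 + t) + (1 - t) * ln (1 - t) - 4 / 9 * t ^ 3)
    (fun t => / (1 + t) - ln (1 - t) - 1 - 4 / 3 * t ^ 2) 0 w) as H.
  cbv beta in H. rewrite Rminus_0_r, Rplus_0_r, ln_1 in H.
  cut (0 + 1 * 0 - 4 / 9 * 0 ^ 3 <=
       ln (1 + w) + (1 - w) * ln (1 - w) - 4 / 9 * w ^ 3); [lra|].
  apply H; [lra | |].
  + intros t Ht. auto_derive; [lra | unfold Rminus; field; lra].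
  + intros t Ht. destruct (ln_1_sub_bounds t) as [Hl _]; [lra|].
    cut (0 <= / (1 + t) + (t + t ^ 2 / 2 + t ^ 3 / 3) - 1 - 4 / 3 * t ^ 2); [lra|].
    replace (/ (1 + t) + (t + t ^ 2 / 2 + t ^ 3 / 3) - 1 - 4 / 3 * t ^ 2)
      with (t ^ 2 * (1 / 6 - t / 2 + t ^ 2 / 3) * / (1 + t)) by (field; lra).
    apply Rmult_le_pos; [nra | left; apply Rinv_0_lt_compat; lra].
- pose proof (le_of_is_derive_nonneg
    (fun t => t ^ 3 / 2 - (ln (1 + t) + (1 - t) * ln (1 - t)))
    (fun t => 3 / 2 * t ^ 2 + 1 - / (1 + t) + ln (1 - t)) 0 w) as H.
  cbv beta in H. rewrite Rminus_0_r, Rplus_0_r, ln_1 in H.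
  cut (0 ^ 3 / 2 - (0 + 1 * 0) <=
       w ^ 3 / 2 - (ln (1 + w) + (1 - w) * ln (1 - w))); [lra|].
  apply H; [lra | |].
  + intros t Ht. auto_derive; [lra | unfold Rminus; field; lra].
  + intros t Ht. destruct (ln_1_sub_bounds t) as [_ Hl]; [lra|].
    cut (0 <= 3 / 2 * t ^ 2 + 1 - / (1 + t) - (t + t ^ 2 / 2 + t ^ 3 / 2)); [lra|].
    replace (3 / 2 * t ^ 2 + 1 - / (1 + t) - (t + t ^ 2 / 2 + t ^ 3 / 2))
      with (t ^ 3 * (1 - t) / 2 * / (1 + t)) by (field; lra).
    apply Rmult_le_pos; [|left; apply Rinv_0_lt_compat; lra].
    pose proof (pow_le t 3). nra.
Qed.

(** * The increment [g_m] and the final polynomial inequality *)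

Definition gap (x : R) : R :=
  (x + 1) * ln ((x + 2) / (x + 1)) - x * ln ((x + 1) / x).

(** With [w = / (x + 1)], [gap x] is [x + 1] times the expression of [ln_cubic_bounds]; [2 <= x]
    means [w <= 1 / 3]. *)
Lemma gap_bounds (x : R) :
  2 <= x -> 4 / 9 / (x + 1) ^ 2 <= gap x <= 1 / 2 / (x + 1) ^ 2.
Proof.
intros Hx.
assert (Hi : 0 < / (x + 1)) by (apply Rinv_0_lt_compat; lra).
assert (Hw : 0 <= / (x + 1) <= 1 / 3).
{ split; [lra|]. replace (1 / 3) with (/ 3) by lra. apply Rinv_le_contravar; lra. }
pose proof (ln_cubic_bounds _ Hw) as H.
assert (E : gap x = (x + 1) *
  (ln (1 + / (x + 1)) + (1 - / (x + 1)) * ln (1 - / (x + 1)))).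
{ unfold gap.
  replace (1 + / (x + 1)) with ((x + 2) / (x + 1)) by (field; lra).
  replace (ln (1 - / (x + 1))) with (- ln ((x + 1) / x)).
  - field. lra.
  - rewrite <- ln_Rinv by (apply Rdiv_lt_0_compat; lra). f_equal. field. lra. }
rewrite E.
replace (4 / 9 / (x + 1) ^ 2) with ((x + 1) * (4 / 9 * (/ (x + 1)) ^ 3))
  by (field; lra).
replace (1 / 2 / (x + 1) ^ 2) with ((x + 1) * ((/ (x + 1)) ^ 3 / 2))
  by (field; lra).
split; apply Rmult_le_compat_l; lra.
Qed.

(** This is [m e^d + (m + 2) e^(-z) < 2 (m + 1)] with both exponentials replaced by their quadratic
    upper bounds; [p] stands for [D_m]. *)
Lemma excess_polynomial_bound (m p : R) :
  2 <= m -> 0 <= p -> (p + 1 / 2) ^ 2 <= m / 5 ->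
  let z := 4 / 9 / (m + 1) ^ 3 + p / (m * (m + 1)) in
  let d := p / (m * (m - 1)) in
  m * (1 + d + 3 / 5 * d ^ 2) + (m + 2) * (1 - z + z ^ 2 / 2) < 2 * (m + 1).
Proof.
intros Hm Hp H z d.
(* A linear bound on [p], from the tangent to [p ^ 2] at [3 / 10]. *)
assert (Hpm : p <= m / 8 - 1 / 10) by (pose proof (pow2_ge_0 (p - 3 / 10)); lra).
assert (Hq : p ^ 2 <= m / 5 - 1 / 4 - p) by lra.
(* Clearing the denominator [M] leaves [A * p ^ 2 + B p] with [B] affine. As [A >= 0], bounding
   [p ^ 2] by [Hq] gives the affine majorant [L]. *)
set (A := 3 / 5 * m * (m + 1) ^ 6 + (m + 2) / 2 * (m - 1) ^ 2 * (m + 1) ^ 4).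
set (B := fun p : R => 2 * p * m * (m - 1) * (m + 1) ^ 5
  + (m + 2) / 2 * (m - 1) ^ 2 * (16 / 81 * m ^ 2 + 8 / 9 * p * m * (m + 1) ^ 2)
  - 4 / 9 * (m + 2) * m ^ 2 * (m - 1) ^ 2 * (m + 1) ^ 3).
set (L := fun p => A * (m / 5 - 1 / 4 - p) + B p).
set (M := m ^ 2 * (m - 1) ^ 2 * (m + 1) ^ 6).
assert (HM : 0 < M)
  by (unfold M; apply Rmult_lt_0_compat; [apply Rmult_lt_0_compat|];
      apply pow_lt; lra).
assert (E : m * (1 + d + 3 / 5 * d ^ 2) + (m + 2) * (1 - z + z ^ 2 / 2)
            - 2 * (m + 1) = (A * p ^ 2 + B p) / M)
  by (unfold A, B, M, d, z; field; lra).
cut (A * p ^ 2 + B p < 0).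
{ intros HN. apply Rminus_lt. rewrite E.
  apply (Rmult_lt_reg_r M); [easy|]. unfold Rdiv.
  rewrite Rmult_assoc, Rinv_l by lra. lra. }
assert (HA : 0 <= A).
{ assert (0 <= m + 1) by lra. pose proof (pow_le (m + 1) 6).
  pose proof (pow_le (m + 1) 4). pose proof (pow2_ge_0 (m - 1)).
  unfold A. apply Rplus_le_le_0_compat; repeat apply Rmult_le_pos; lra. }
apply Rle_lt_trans with (L p).
{ unfold L. pose proof (Rmult_le_compat_l A _ _ HA Hq). lra. }
(* [L] is affine, so it suffices to look at the two ends of the range of [p];
   there it is a polynomial in [m - 2] with negative coefficients only. *)
set (P := m / 8 - 1 / 10) in *.
assert (HP : 0 < P) by (unfold P; lra).
assert (Haff : L p * P = (P - p) * L 0 + p * L P)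
  by (unfold L, B; field).
set (k := m - 2). assert (Hk : 0 <= k) by (unfold k; lra).
assert (Hpow : forall n, 0 <= k ^ n) by (intros n; now apply pow_le).
assert (H0 : L 0 < 0).
{ unfold L, A, B. replace m with (k + 2) by (unfold k; ring).
  pose proof (Hpow 2%nat); pose proof (Hpow 3%nat); pose proof (Hpow 4%nat);
  pose proof (Hpow 5%nat); pose proof (Hpow 6%nat); pose proof (Hpow 7%nat);
  pose proof (Hpow 8%nat). lra. }
assert (H1 : L P < 0).
{ unfold L, A, B, P. replace m with (k + 2) by (unfold k; ring).
  pose proof (Hpow 2%nat); pose proof (Hpow 3%nat); pose proof (Hpow 4%nat);
  pose proof (Hpow 5%nat); pose proof (Hpow 6%nat); pose proof (Hpow 7%nat);
  pose proof (Hpow 8%nat). lra. }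
clearbody L P. assert (L p * P < 0).
{ destruct (Rle_lt_or_eq_dec _ _ Hp) as [Hp' | <-]; nra. }
nra.
Qed.

(** * Recursion and growth of the defect *)

Definition lnfact (n : nat) : R := ln (INR (fact n)).

Lemma lnfact_S (n : nat) : lnfact (S n) = ln (INR n + 1) + lnfact n.
Proof.
unfold lnfact. rewrite fact_simpl, mult_INR, ln_mult, S_INR; trivial.
- rewrite S_INR. pose proof (pos_INR n). lra.
- apply INR_fact_lt_0.
Qed.

(* [n (n - 1)] times the amount by which [ln (a_n / a_(n-1))] falls short of
   [ln ((n + 1) / n)], where [a_n] is the [n]-th root of [n!]. *)
Definition defect (n : nat) : R :=
  INR n * (INR n - 1) * ln ((INR n + 1) / INR n) - INR n * ln (INR n) + lnfact n.

Lemma defect_S (n : nat) :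
  (2 <= n)%nat -> defect (S n) = defect n + INR n * gap (INR n).
Proof.
intros Hn. apply le_INR in Hn. simpl in Hn.
unfold defect, gap. rewrite lnfact_S, S_INR.
replace (INR n + 1 + 1) with (INR n + 2) by ring.
unfold Rdiv. rewrite !ln_mult, !ln_Rinv; try lra; try (apply Rinv_0_lt_compat; lra).
Qed.

(** Each increment [e] is at most [1 / (2 (n + 2))], so the square grows by at most
    [1 / 6 + 1 / 64 < 1 / 5] per step. *)
Lemma defect_bounds (n : nat) :
  (2 <= n)%nat -> 0 <= defect n /\ (defect n + 1 / 2) ^ 2 <= INR n / 5.
Proof.
induction 1 as [|n Hn [IH0 IH]].
- assert (E : defect 2 = ln (9 / 8)).
  { unfold defect, lnfact. simpl.
    replace (9 / 8) with ((1 + 1 + 1) / (1 + 1) * ((1 + 1 + 1) / (1 + 1)) / (1 + 1))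
      by field.
    unfold Rdiv. rewrite !ln_mult, !ln_Rinv; try lra. }
  rewrite E. simpl INR.
  assert (0 <= ln (9 / 8)) by (rewrite <- ln_1; apply ln_le; lra).
  assert (ln (9 / 8) <= 1 / 8).
  { rewrite <- (ln_exp (1 / 8)). apply ln_le; [lra|].
    pose proof (exp_ineq1_le (1 / 8)). lra. }
  split; [easy | nra].
- rewrite defect_S by easy. rewrite S_INR.
  apply le_INR in Hn. simpl in Hn.
  set (x := INR n) in *. set (D := defect n) in *.
  destruct (gap_bounds x) as [Hl Hu]; [lra|].
  assert (Hg : 0 <= gap x).
  { eapply Rle_trans; [|apply Hl].
    apply Rmult_le_pos; [lra | left; apply Rinv_0_lt_compat, pow_lt; lra]. }
  assert (He : x * gap x * (x + 2) <= 1 / 2).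
  { assert (gap x * (x + 1) ^ 2 <= 1 / 2).
    { apply (Rmult_le_compat_r ((x + 1) ^ 2)) in Hu; [|apply pow_le; lra].
      replace (1 / 2 / (x + 1) ^ 2 * (x + 1) ^ 2) with (1 / 2) in Hu by (field; lra).
      easy. }
    nra. }
  assert (0 <= x * gap x) by nra.
  set (e := x * gap x) in *. split; [lra|].
  assert (e <= 1 / 8) by nra.
  (* Here [x / 5 <= ((x + 2) / 6) ^ 2], because [(x + 2) ^ 2 >= 8 * x]. *)
  assert (D + 1 / 2 <= (x + 2) / 6) by nra.
  assert (2 * (D + 1 / 2) * e <= 1 / 6) by nra.
  nra.
Qed.

(** * Strict concavity of [root_fact] *)

Definition root_fact (n : nat) : R := nroot n (INR (fact n)).

Lemma root_fact_exp (n : nat) : root_fact n = exp (lnfact n / INR n).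
Proof. unfold root_fact, nroot, Rpower, lnfact, Rdiv. f_equal. ring. Qed.

Lemma sigma_root_fact (n : nat) : sigma_ n = root_fact (S n) - root_fact n.
Proof. unfold sigma_. now rewrite Nat.add_1_r. Qed.

(* Dividing by [root_fact m], [m = n + 1], turns the claim into
   [m e^d + (m + 2) e^(-z) < 2 (m + 1)]. *)
Lemma root_fact_concave (n : nat) :
  (1 <= n)%nat ->
  root_fact n + root_fact (S (S n)) < 2 * root_fact (S n).
Proof.
intros Hn.
destruct (defect_bounds (S n)) as [HD0 HD]; [lia|].
assert (Hm : 2 <= INR (S n)) by (apply (le_INR 2); lia).
set (D := defect (S n)) in *. set (m := INR (S n)) in *.
assert (Em : INR n = m - 1) by (unfold m; rewrite S_INR; ring).
assert (Fn : lnfact n = lnfact (S n) - ln m)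
  by (rewrite lnfact_S; unfold m; rewrite S_INR; ring).
assert (FS : lnfact (S (S n)) = lnfact (S n) + ln (m + 1))
  by (rewrite (lnfact_S (S n)); fold m; ring).
assert (ED : D = m * (m - 1) * ln ((m + 1) / m) - m * ln m + lnfact (S n))
  by reflexivity.
rewrite !root_fact_exp, Fn, FS, Em.
rewrite (S_INR (S n)). fold m.
set (f := lnfact (S n)) in *.
destruct (gap_bounds m Hm) as [Hg _].
(* By [defect_S], [z] is [defect (S (S n)) / (m * (m + 1))], the analogue of [d] one index later;
   [z0] puts the lower bound for [gap m] in its place. *)
set (d := D / (m * (m - 1))).
set (z := (gap m + D / m) / (m + 1)).
set (z0 := 4 / 9 / (m + 1) ^ 3 + D / (m * (m + 1))).
assert (Hz : z0 <= z).
{ replace z0 with ((4 / 9 / (m + 1) ^ 2 + D / m) / (m + 1))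
    by (unfold z0; field; lra).
  apply Rmult_le_compat_r; [left; apply Rinv_0_lt_compat; lra | lra]. }
assert (Hz0 : 0 <= z0).
{ unfold z0. apply Rplus_le_le_0_compat.
  - apply Rmult_le_pos; [lra | left; apply Rinv_0_lt_compat, pow_lt; lra].
  - apply Rmult_le_pos; [lra | left; apply Rinv_0_lt_compat; nra]. }
assert (Hd : 0 <= d <= 1 / 10).
{ assert (0 < m * (m - 1)) by nra. split.
  - apply Rmult_le_pos; [lra | left; now apply Rinv_0_lt_compat].
  - apply (Rmult_le_reg_r (m * (m - 1))); [easy|]. unfold d, Rdiv.
    rewrite Rmult_assoc, Rinv_l by lra.
    (* The square gives [2 * D <= (D + 1 / 2) ^ 2 <= m / 5], and [m - 1 >= 1]. *)
    pose proof (pow2_ge_0 (D - 1 / 2)). nra. }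
assert (Elow : exp ((f - ln m) / (m - 1)) = exp (f / m) * (exp d * (m / (m + 1)))).
{ rewrite <- (exp_ln (m / (m + 1))) by (apply Rdiv_lt_0_compat; lra).
  rewrite <- !exp_plus. f_equal. unfold d. rewrite ED.
  unfold Rdiv. rewrite !ln_mult, !ln_Rinv; try lra;
    try (apply Rinv_0_lt_compat; lra).
  field; lra. }
assert (Eup : exp ((f + ln (m + 1)) / (m + 1))
              = exp (f / m) * (exp (- z) * ((m + 2) / (m + 1)))).
{ rewrite <- (exp_ln ((m + 2) / (m + 1))) by (apply Rdiv_lt_0_compat; lra).
  rewrite <- !exp_plus. f_equal. unfold z, gap. rewrite ED.
  unfold Rdiv. rewrite !ln_mult, !ln_Rinv; try lra;
    try (apply Rinv_0_lt_compat; lra).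
  field; lra. }
rewrite Elow, Eup.
pose proof (exp_le_quadratic d Hd) as H1.
pose proof (exp_neg_le_quadratic z0 Hz0) as H2.
assert (H3 : exp (- z) <= exp (- z0)).
{ destruct (Req_dec z z0) as [-> | Hne]; [lra|].
  left. apply exp_increasing. lra. }
pose proof (excess_polynomial_bound m D Hm HD0 HD) as H4.
cbv zeta in H4. fold d z0 in H4.
assert (H5 : m * exp d + (m + 2) * exp (- z) < 2 * (m + 1)) by nra.
rewrite <- Rmult_plus_distr_l, (Rmult_comm 2).
apply Rmult_lt_compat_l; [apply exp_pos|].
apply (Rmult_lt_reg_r (m + 1)); [lra|].
replace ((exp d * (m / (m + 1)) + exp (- z) * ((m + 2) / (m + 1))) * (m + 1))
  with (m * exp d + (m + 2) * exp (- z)) by (field; lra).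
easy.
Qed.

(** * Monotonicity of [sigma_] and its telescoping bounds *)

Lemma sigma_lt (n : nat) : (1 <= n)%nat -> sigma_ (S n) < sigma_ n.
Proof.
intros Hn. rewrite !sigma_root_fact. pose proof (root_fact_concave n Hn). lra.
Qed.

Lemma sigma_add_le (n k : nat) : (1 <= n)%nat -> sigma_ (n + k) <= sigma_ n.
Proof.
intros Hn. induction k as [|k IH].
- rewrite Nat.add_0_r. lra.
- rewrite Nat.add_succ_r. assert (H : (1 <= n + k)%nat) by lia.
  apply sigma_lt in H. lra.
Qed.

Lemma root_fact_add_le (n k : nat) :
  (1 <= n)%nat -> root_fact (n + k) - root_fact n <= INR k * sigma_ n.
Proof.
intros Hn. induction k as [|k IH].
- rewrite Nat.add_0_r. simpl. lra.
- rewrite Nat.add_succ_r, S_INR. pose proof (sigma_add_le n k Hn) as H.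
  rewrite (sigma_root_fact (n + k)) in H. lra.
Qed.

Lemma root_fact_pos (n : nat) : 0 < root_fact n.
Proof. apply exp_pos. Qed.

(** The right side is [root_fact 1 > 0] plus [sigma_ 1, ..., sigma_ n], each at least [sigma_ n]. *)
Lemma mul_sigma_le (n : nat) : (1 <= n)%nat -> INR n * sigma_ n <= root_fact (S n).
Proof.
induction 1 as [|n Hn IH].
- rewrite sigma_root_fact. simpl INR. pose proof (root_fact_pos 1). lra.
- rewrite S_INR. pose proof (sigma_lt n Hn). pose proof (pos_INR n).
  pose proof (root_fact_pos (S n)).
  pose proof (sigma_root_fact (S n)). nra.
Qed.

(** * Limits *)

Lemma is_lim_seq_inv_INR : is_lim_seq (fun n => / INR n) 0.
Proof.
replace (Finite 0) with (Rbar_inv p_infty) by reflexivity.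
apply is_lim_seq_inv; [apply is_lim_seq_INR | easy].
Qed.

(* [ln (root_fact n / n) = defect n / n - (n - 1) ln (1 + 1 / n)]; the first
   term is [O(1 / sqrt n)], the second tends to [1]. *)
Lemma ln_root_fact_div_bounds (n : nat) :
  (2 <= n)%nat ->
  - 1 <= lnfact n / INR n - ln (INR n) <= sqrt (/ INR n) - 1 + 2 * / INR n.
Proof.
intros Hn. destruct (defect_bounds n Hn) as [HD0 HD].
apply le_INR in Hn. simpl in Hn.
assert (E : lnfact n / INR n - ln (INR n) =
  defect n * / INR n - (INR n - 1) * ln ((INR n + 1) / INR n))
  by (unfold defect; field; lra).
rewrite E. set (x := INR n) in *. set (D := defect n) in *.
assert (Hx : 0 < / x) by (apply Rinv_0_lt_compat; lra).
assert (Hxx : x * / x = 1) by (apply Rinv_r; lra).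
assert (Hu : ln ((x + 1) / x) <= / x).
{ rewrite <- (ln_exp (/ x)). apply ln_le; [apply Rdiv_lt_0_compat; lra|].
  replace ((x + 1) / x) with (1 + / x) by (field; lra). apply exp_ineq1_le. }
assert (Hl : / (x + 1) <= ln ((x + 1) / x)).
{ replace ((x + 1) / x) with (/ (1 + - / (x + 1))) by (field; lra).
  assert (0 < 1 + - / (x + 1)).
  { replace (1 + - / (x + 1)) with (x / (x + 1)) by (field; lra).
    apply Rdiv_lt_0_compat; lra. }
  rewrite ln_Rinv by easy.
  pose proof (exp_ineq1_le (- / (x + 1))) as He.
  apply ln_le in He; [|easy]. rewrite ln_exp in He. lra. }
assert (HDx : 0 <= D * / x) by (apply Rmult_le_pos; lra).
split; [nra|].
(* The defect bound gives [D ^ 2 <= x]. *)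
assert (HDs : D * / x <= sqrt (/ x)).
{ rewrite <- (sqrt_pow2 (D * / x)) by easy. apply sqrt_le_1_alt.
  replace ((D * / x) ^ 2) with (D ^ 2 * / x * / x) by ring.
  assert (D ^ 2 <= x) by nra.
  assert (D ^ 2 * / x <= 1) by nra. nra. }
assert (Hfrac : 1 - 2 * / x <= (x - 1) * / (x + 1)).
{ replace ((x - 1) * / (x + 1)) with (1 - 2 * / (x + 1)) by (field; lra).
  assert (/ (x + 1) <= / x) by (apply Rinv_le_contravar; lra). lra. }
nra.
Qed.

Lemma is_lim_seq_root_fact_div :
  is_lim_seq (fun n => root_fact n / INR n) (exp (- 1)).
Proof.
apply is_lim_seq_ext_loc with (fun n => exp (lnfact n / INR n - ln (INR n))).
{ exists 1%nat. intros n Hn. apply (lt_INR 0) in Hn. simpl in Hn.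
  rewrite root_fact_exp. unfold Rminus. rewrite exp_plus, exp_Ropp, exp_ln; easy. }
apply (is_lim_seq_continuous exp).
{ apply derivable_continuous_pt, derivable_pt_exp. }
apply is_lim_seq_le_le_loc with
  (fun _ => - 1) (fun n => sqrt (/ INR n) - 1 + 2 * / INR n).
- exists 2%nat. intros n Hn. now apply ln_root_fact_div_bounds.
- apply is_lim_seq_const.
- replace (Finite (- 1)) with (Finite (sqrt 0 - 1 + 2 * 0))
    by (rewrite sqrt_0; f_equal; ring).
  apply is_lim_seq_plus'; [apply is_lim_seq_minus'|].
  + apply (is_lim_seq_continuous sqrt); [|apply is_lim_seq_inv_INR].
    apply continuity_pt_sqrt. lra.
  + apply is_lim_seq_const.
  + apply (is_lim_seq_scal_l _ 2 0), is_lim_seq_inv_INR.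
Qed.

Lemma is_lim_seq_sigma : is_lim_seq sigma_ (exp (- 1)).
Proof.
(* The bounds [(a_(2n) - a_n) / n] and [a_(n+1) / n] are rewritten through [a_k / k], so the lower
   one tends to [2 / e - 1 / e]. *)
apply is_lim_seq_le_le_loc with
  (fun n => 2 * (root_fact (2 * n) / INR (2 * n)) - root_fact n / INR n)
  (fun n => (1 + / INR n) * (root_fact (S n) / INR (S n))).
- exists 1%nat. intros n Hn.
  pose proof (root_fact_add_le n n Hn) as Hl. pose proof (mul_sigma_le n Hn) as Hu.
  apply (lt_INR 0) in Hn. simpl in Hn.
  replace (n + n)%nat with (2 * n)%nat in Hl by lia.
  rewrite mult_INR, (S_INR n). simpl (INR 2).
  split; apply (Rmult_le_reg_l (INR n)); try easy.
  + eapply Rle_trans; [|apply Hl]. right. field. lra.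
  + eapply Rle_trans; [apply Hu|]. right. field. lra.
- replace (Finite (exp (- 1))) with (Finite (2 * exp (- 1) - exp (- 1)))
    by (f_equal; ring).
  apply is_lim_seq_minus'; [|apply is_lim_seq_root_fact_div].
  apply (is_lim_seq_scal_l _ 2 (exp (- 1))).
  apply (is_lim_seq_subseq (fun n => root_fact n / INR n) _ (fun n => 2 * n)%nat).
  + apply eventually_subseq. intros n. lia.
  + apply is_lim_seq_root_fact_div.
- replace (Finite (exp (- 1))) with (Finite ((1 + 0) * exp (- 1)))
    by (f_equal; ring).
  apply is_lim_seq_mult'.
  + apply is_lim_seq_plus'; [apply is_lim_seq_const | apply is_lim_seq_inv_INR].
  + apply (is_lim_seq_incr_1 (fun n => root_fact n / INR n)),
      is_lim_seq_root_fact_div.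
Qed.

(** The limit is at most [sigma_ (S n)]; the strict drop from [sigma_ n] to it supplies
    strictness. *)
Lemma lim_lt_sigma (n : nat) : (1 <= n)%nat -> exp (- 1) < sigma_ n.
Proof.
intros Hn. apply Rle_lt_trans with (sigma_ (S n)); [|now apply sigma_lt].
apply (is_lim_seq_le (fun k => sigma_ (k + S n)) (fun _ => sigma_ (S n))
         (exp (- 1)) (sigma_ (S n))).
- intros k. rewrite Nat.add_comm. apply sigma_add_le. lia.
- apply is_lim_seq_incr_n, is_lim_seq_sigma.
- apply is_lim_seq_const.
Qed.

Lemma sigma_1_lt : sigma_ 1 < 0.42.
Proof.
unfold sigma_, nroot. simpl.
replace (/ (1 + 1)) with (/ 2) by lra.
rewrite Rinv_1, Rpower_1, Rpower_sqrt by lra.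
(* The goal is now [sqrt 2 - 1 < 0.42], and [1.42 ^ 2 = 2.0164]. *)
assert (sqrt (1 + 1) < 1.42); [|lra].
rewrite <- (sqrt_pow2 1.42) by lra. apply sqrt_lt_1; lra.
Qed.

Theorem theorem6p1 :
  is_lim_seq sigma_ (Finite (1 / exp 1)) /\
  (sigma_ 1 < 0.42 /\
   (forall n : nat, (1 <= n)%nat -> sigma_ (n + 1) < sigma_ n) /\
   (forall n : nat, (1 <= n)%nat -> 1 / exp 1 < sigma_ n)).
Proof.
replace (1 / exp 1) with (exp (- 1)) by (change (-1) with (- (1)); rewrite exp_Ropp; lra).
split; [exact is_lim_seq_sigma|].
split; [exact sigma_1_lt|].
split; [|exact lim_lt_sigma].
intros n Hn. rewrite Nat.add_1_r. now apply sigma_lt.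
Qed.
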